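(* Work in the setting of the context (linear observation model $b=Ax^*+\varpi$ with $x^*\in\mathcal{X}$, $\overline{S}=\{i:x^*_{J_i}\ne0\}$, $\overline{r}=|\overline{S}|$, loss $\vartheta$ with $\vartheta^2$ strongly convex of modulus $\overline\rho$, and $\{x^k\}$ generated by the inexact proximal MM algorithm). Let $c>2$ be a constant. Suppose there is $\kappa>0$ such that $\frac{1}{2n}\|Ax\|^2\ge\kappa\|x\|^2$ for all $x\in\mathcal{C}(\overline{S},1.5\overline{r})$, and suppose that for some $k\in\mathbb{N}$, $k\ge1$, one has $S^{k-1}\supset\overline{S}$, $|S^{k-1}|\le1.5\overline{r}$ and $\max_{i\in(S^{k-1})^c}w_i^{k-1}\le\frac12$. If $$\lambda\in\Big[c\big(\|G(\xi^k)\|_\infty+2L_\vartheta\|A\|\big),\ \frac{2\mu\vartheta(\varpi)+n\kappa\overline{\rho}-\frac{3c}{c-2}L_\vartheta\|A\|_{2,\infty}\big(L_\vartheta\|A\|+\|G(\xi^k)\|_\infty\big)|S^{k-1}|}{\frac{3c}{c-2}L_\vartheta\|A\|_{2,\infty}\|v^{k-1}_{\overline{S}}\|_\infty|S^{k-1}|}\Big),$$ then $\|x^k-x^*\|\le\frac{d_1}{d_2}$, where $$d_1:=2\vartheta(\varpi)\big(L_\vartheta\|A\|+\|G(\xi^k)\|_\infty+\lambda\|v^{k-1}_{\overline{S}}\|_\infty\big)\sqrt{|S^{k-1}|},$$ $$d_2:=2\mu\vartheta(\varpi)+n\kappa\overline{\rho}-\tfrac{3c}{c-2}L_\vartheta\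|A\|_{2,\infty}\big(L_\vartheta\|A\|+\|G(\xi^k)\|_\infty+\lambda\|v^{k-1}_{\overline{S}}\|_\infty\big)|S^{k-1}|.$$
   Context: Data. $A\in\mathbb{R}^{n\times p}$; $\mathcal{X}\subseteq\mathbb{R}^p$ nonempty closed convex; $J_1,\dots,J_m$ a partition of $\{1,\dots,p\}$; $x_{J_i}$ is the subvector of $x$ indexed by $J_i$, $A_{J_i}$ the submatrix of columns indexed by $J_i$; $G(x):=(\|x_{J_1}\|,\dots,\|x_{J_m}\|)^{\top}$. $\|\cdot\|$ is the Euclidean norm, and the spectral norm for matrices; $\|A\|_{2,\infty}:=\max_{1\le i\le m}\|A_{J_i}\|$; $\|x\|_M^2:=\langle x,Mx\rangle$; $e$ is the all-ones vector; $[m]=\{1,\dots,m\}$; $v_S$ is the subvector of $v$ indexed by $S$. Observation model: $b=Ax^*+\varpi$, where $x^*\in\mathcal{X}$ is the true vector and $\varpi\in\mathbb{R}^n$ the noise; $\overline{S}:=\{i\in[m]:x^*_{J_i}\ne0\}$, $\overline{r}:=|\overline{S}|$. Assumption on $\vartheta$. $\vartheta:\mathbb{R}^n\to\mathbb{R}$ is convex and globally Lipschitz continuous with modulus $L_\vartheta$ on $\mathcal{Z}:=\{Az-b:z\in\mathcal{X}\}$; $\vartheta(0)\le0$, $\vartheta(u+v)\le\vartheta(u)+\vartheta(v)$ and $\vartheta(-u)=\vartheta(u)$ for all $u,v\in\mathbb{R}^n$; and $\vartheta^2$ is strongly convex with modulus $\overline\rho>0$ (i.e. $\vartheta^2-\frac{\overline\rho}{2}\|\cdot\|^2$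 is convex). Cone. For a positive number $r$ and the constant $c>2$, $\mathcal{C}(\overline{S},r)$ is the set of $x\in\mathbb{R}^p$ for which there exists $S\supset\overline{S}$ with $|S|\le r$ and $\sum_{i\in S^c}\|x_{J_i}\|\le\frac{2(c+1)}{c-2}\sum_{i\in S}\|x_{J_i}\|$. Function classes. $\mathscr{L}$ is the set of closed proper convex $\phi:\mathbb{R}\to(-\infty,\infty]$ with ${\rm int}({\rm dom}\,\phi)\supseteq[0,1]$, $\phi(1)=1$, $\phi(t^* )=0$ where $t^*=\arg\min_{0\le t\le1}\phi(t)$; $\mathscr{L}_1$ is the set of $\phi\in\mathscr{L}$ strictly convex on $[0,1]$. $\psi:=\phi$ on $[0,1]$, $+\infty$ elsewhere; $\psi^*$ is its convex conjugate (continuously differentiable when $\phi\in\mathscr{L}_1$). Algorithm (inexact proximal MM). Choose $\phi\in\mathscr{L}_1$, $\mu>0$, $\nu>0$, $\rho\ge1$, $\varrho\in(0,1]$, $0<\underline{\gamma_1}\le\gamma_{1,0}$, $0<\underline{\gamma_2}\le\gamma_{2,0}$, and $x^0\in\mathcal{X}$ (an approximate minimizer over $\mathcal X$ of $\vartheta(Ax-b)+\widetilde\lambda\langle e,G(x)\rangle+\frac{\widetilde\gamma_{1,0}}{2}\|x\|^2+\frac{\widetilde\gamma_{2,0}}{2}\|Ax\|^2$ for some $\widetilde\lambda>0$, $\widetilde\gamma_{1,0}\ge\gamma_{1,0}$, $\widetilde\gamma_{2,0}\ge\gamma_{2,0}$); put $x^{-1}:=x^0$, $\lambda:=\rho\nu$,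 $Q:=\underline{\gamma_1}I+\underline{\gamma_2}A^{\top}A$. For $k=0,1,2,\dots$: set $w_i^k:=(\psi^* )'(\rho\|x^k_{J_i}\|)$, $i\in[m]$, and $v^k:=e-w^k$; take any $\delta^k\in\mathbb{R}^p$ with $\|\delta^k\|\le\frac{\|Q^{1/2}(x^k-x^{k-1})\|}{\sqrt2\|Q^{-1/2}\|}$; set $Q_k:=\gamma_{1,k}I+\gamma_{2,k}A^{\top}A$ and let $x^{k+1}$ be the unique minimizer over $x\in\mathcal{X}$ of $\vartheta(Ax-b)+\frac{\mu}{2}\|x\|^2+\lambda\langle v^k,G(x)\rangle+\frac12\|x-x^k\|^2_{Q_k}-\langle\delta^k,x-x^k\rangle$; update $\gamma_{j,k+1}:=\max(\underline{\gamma_j},\varrho\gamma_{j,k})$, $j=1,2$. Notation along the iterates. $S^{k}:=\{i\in[m]:x^k_{J_i}\ne0\}$ and $\xi^k:=Q_{k-1}(x^{k-1}-x^k)+\delta^{k-1}-\mu x^*$. *)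

(* Defs.v *)
From HB Require Import structures.
From mathcomp Require Import all_boot all_order all_algebra.
From mathcomp Require Import all_classical all_reals all_analysis.

Set Implicit Arguments.
Unset Strict Implicit.
Unset Printing Implicit Defensive.

Import Order.TTheory GRing.Theory Num.Theory.
Import numFieldNormedType.Exports.

Local Open Scope classical_set_scope.
Local Open Scope ring_scope.

Section Norms.
Context {R : realType}.

Definition dotv {d : nat} (u v : 'cV[R]_d) : R := \sum_(i < d) u i 0 * v i 0.

(* The norm `|_| which MathComp-Analysis puts on matrices is the max norm, so
   the Euclidean and the spectral norms are defined here. *)
Definition enorm {d : nat} (u : 'cV[R]_d) : R := Num.sqrt (dotv u u).

Definition supnorm {d : nat} (u : 'cV[R]_d) : R := mx_norm u.

Definition specnorm {d1 d2 : nat} (M : 'M[R]_(d1, d2)) : R :=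
  sup [set enorm (M *m u) | u in [set u : 'cV[R]_d2 | enorm u <= 1]].

Definition sqnormM {d : nat} (M : 'M[R]_d) (u : 'cV[R]_d) : R :=
  dotv u (M *m u).

(* The default value 0 is never reached when Q is symmetric positive semidefinite. *)
Definition sqrtm {d : nat} (Q : 'M[R]_d) : 'M[R]_d :=
  xget 0 [set B : 'M[R]_d |
    [/\ B^T = B, forall u, 0 <= dotv u (B *m u) & B *m B = Q]].

End Norms.

Section Blocks.
Context {R : realType}.

Definition subvec {d : nat} (I : {set 'I_d}) (u : 'cV[R]_d) : 'cV[R]_#|I| :=
  rowsub (fun k : 'I_#|I| => enum_val k) u.

Definition subcols {n p : nat} (I : {set 'I_p}) (A : 'M[R]_(n, p)) :
    'M[R]_(n, #|I|) :=
  colsub (fun k : 'I_#|I| => enum_val k) A.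

(* Injectivity is what makes the blocks pairwise disjoint as an indexed
   family; nonemptiness of the blocks is part of partition. *)
Definition block_partition {p m : nat} (J : 'I_m -> {set 'I_p}) : Prop :=
  injective J /\
  finset.partition (J @: finset.setTfor 'I_m) (finset.setTfor 'I_p).

Definition G {p m : nat} (J : 'I_m -> {set 'I_p}) (x : 'cV[R]_p) : 'cV[R]_m :=
  \col_i enorm (subvec (J i) x).

Definition bsupp {p m : nat} (J : 'I_m -> {set 'I_p}) (x : 'cV[R]_p) :
    {set 'I_m} :=
  finset (fun i => subvec (J i) x != 0).

Definition norm2inf {n p m : nat} (J : 'I_m -> {set 'I_p})
    (A : 'M[R]_(n, p)) : R :=
  \big[Num.max/0]_(i < m) specnorm (subcols (J i) A).

Definition cone {p m : nat} (J : 'I_m -> {set 'I_p}) (c : R)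
    (Sbar : {set 'I_m}) (r : R) : set 'cV[R]_p :=
  [set x | exists S : {set 'I_m},
    [/\ Sbar \subset S, #|S|%:R <= r &
        \sum_(i in ~: S) enorm (subvec (J i) x)
          <= 2 * (c + 1) / (c - 2) * \sum_(i in S) enorm (subvec (J i) x)]].

End Blocks.

Definition argmin {T : Type} {disp} {U : porderType disp}
    (D : set T) (f : T -> U) : set T :=
  [set x | D x /\ forall y, D y -> (f x <= f y)%O].

Section LossFunction.
Context {R : realType}.

Record loss_assumption {n p : nat} (A : 'M[R]_(n, p)) (b : 'cV[R]_n)
    (X : set 'cV[R]_p) (theta : 'cV[R]_n -> R) (L rhobar : R) : Prop := {
  loss_convex : convex_function setT (theta : 'cV[R]_n -> R^o);
  loss_L_ge0 : 0 <= L;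
  loss_lipschitz : forall u v : 'cV[R]_n,
    [set A *m z - b | z in X] u -> [set A *m z - b | z in X] v ->
    `|theta u - theta v| <= L * enorm (u - v);
  loss_at0 : theta 0 <= 0;
  loss_subadd : forall u v, theta (u + v) <= theta u + theta v;
  loss_even : forall u, theta (- u) = theta u;
  loss_rhobar_gt0 : 0 < rhobar;
  loss_sq_sconvex : convex_function setT
    ((fun u => theta u ^+ 2 - rhobar / 2 * enorm u ^+ 2) : 'cV[R]_n -> R^o)
}.

End LossFunction.

Section PhiClasses.
Context {R : realType}.
Implicit Type phi : R -> \bar R.

Local Notation I01 := [set t : R | 0 <= t <= 1].

Record class_L (phi : R -> \bar R) : Prop := {
  L_closed : lower_semicontinuous phi;
  L_gtNy : forall t, phi t != -oo%E;
  L_dom : exists t, (phi t < +oo)%E;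
  L_convex : forall (s t a : R), 0 < a < 1 ->
    (phi (a * s + (1 - a) * t)%R <= a%:E * phi s + (1 - a)%:E * phi t)%E;
  L_int_dom : I01 `<=` interior [set t | (phi t < +oo)%E];
  L_at1 : phi 1 = 1%E;
  L_min0 : exists2 tstar : R, argmin I01 phi tstar & phi tstar = 0%E
}.

Definition class_L1 (phi : R -> \bar R) : Prop :=
  class_L phi /\
  forall s t a : R, I01 s -> I01 t -> s != t -> 0 < a < 1 ->
    (phi (a * s + (1 - a) * t)%R < a%:E * phi s + (1 - a)%:E * phi t)%E.

Definition psi phi (t : R) : \bar R := if 0 <= t <= 1 then phi t else +oo%E.

Definition conjugate (f : R -> \bar R) (s : R) : \bar R :=
  ereal_sup [set ((s * t)%:E - f t)%E | t in [set: R]].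

(* fine reads the conjugate of psi, finite on R since psi has the compact
   domain [0, 1], as a real function. *)
Definition dpsi_star phi : R -> R :=
  derive1 (fun s : R => fine (conjugate (psi phi) s)).

Definition wvec phi (rho : R) {p m : nat} (J : 'I_m -> {set 'I_p})
    (x : 'cV[R]_p) : 'cV[R]_m :=
  \col_i dpsi_star phi (rho * enorm (subvec (J i) x)).

Definition vvec phi (rho : R) {p m : nat} (J : 'I_m -> {set 'I_p})
    (x : 'cV[R]_p) : 'cV[R]_m :=
  const_mx 1 - wvec phi rho J x.

End PhiClasses.

Section Algorithm.
Context {R : realType}.

Definition Qmx {n p : nat} (A : 'M[R]_(n, p)) (g1 g2 : R) : 'M[R]_p :=
  g1%:M + g2 *: (A^T *m A).

Definition init_obj {n p m : nat} (A : 'M[R]_(n, p)) (b : 'cV[R]_n)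
    (J : 'I_m -> {set 'I_p}) (theta : 'cV[R]_n -> R) (lamt gt1 gt2 : R)
    (y : 'cV[R]_p) : R :=
  theta (A *m y - b) + lamt * dotv (const_mx 1) (G J y)
  + gt1 / 2 * enorm y ^+ 2 + gt2 / 2 * enorm (A *m y) ^+ 2.

Definition sub_obj {n p m : nat} (A : 'M[R]_(n, p)) (b : 'cV[R]_n)
    (J : 'I_m -> {set 'I_p}) (theta : 'cV[R]_n -> R) (mu lambda : R)
    (v : 'cV[R]_m) (Q : 'M[R]_p) (xk deltak y : 'cV[R]_p) : R :=
  theta (A *m y - b) + mu / 2 * enorm y ^+ 2 + lambda * dotv v (G J y)
  + 2^-1 * sqnormM Q (y - xk) - dotv deltak (y - xk).

(* The iterates of the inexact proximal MM method.  As 0.-1 = 0 in nat, x k.-1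
   encodes the convention that the iterate of index -1 is the initial point.
   No accuracy is prescribed for the initial approximate minimizer, hence the
   arbitrary tolerance eps in pmm_init.  Minimizers in pmm_step are unique, the
   subproblem being strongly convex. *)
Record inexact_pmm {n p m : nat} (A : 'M[R]_(n, p)) (b : 'cV[R]_n)
    (X : set 'cV[R]_p) (J : 'I_m -> {set 'I_p}) (theta : 'cV[R]_n -> R)
    (phi : R -> \bar R) (mu nu rho varrho lambda lg1 lg2 : R)
    (g1 g2 : nat -> R) (delta x : nat -> 'cV[R]_p) : Prop := {
  pmm_phi : class_L1 phi;
  pmm_mu : 0 < mu;
  pmm_nu : 0 < nu;
  pmm_rho : 1 <= rho;
  pmm_varrho : 0 < varrho <= 1;
  pmm_lambda : lambda = rho * nu;
  pmm_lg1 : 0 < lg1 <= g1 0%N;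
  pmm_lg2 : 0 < lg2 <= g2 0%N;
  pmm_x0 : X (x 0%N);
  pmm_init : exists lamt gt1 gt2 eps : R,
    [/\ 0 < lamt, g1 0%N <= gt1, g2 0%N <= gt2, 0 <= eps &
      forall y, X y -> init_obj A b J theta lamt gt1 gt2 (x 0%N)
                       <= init_obj A b J theta lamt gt1 gt2 y + eps];
  pmm_delta : forall k, let Q := Qmx A lg1 lg2 in
    enorm (delta k) <=
      enorm (sqrtm Q *m (x k - x k.-1))
        / (Num.sqrt 2 * specnorm (invmx (sqrtm Q)));
  pmm_step : forall k,
    argmin X (sub_obj A b J theta mu lambda (vvec phi rho J (x k))
                (Qmx A (g1 k) (g2 k)) (x k) (delta k)) (x k.+1);
  pmm_g1 : forall k, g1 k.+1 = Num.max lg1 (varrho * g1 k);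
  pmm_g2 : forall k, g2 k.+1 = Num.max lg2 (varrho * g2 k)
}.

(* Meaningful for k >= 1 only, as 0.-1 = 0. *)
Definition xi_vec {n p : nat} (A : 'M[R]_(n, p)) (mu : R) (g1 g2 : nat -> R)
    (delta x : nat -> 'cV[R]_p) (xs : 'cV[R]_p) (k : nat) : 'cV[R]_p :=
  Qmx A (g1 k.-1) (g2 k.-1) *m (x k.-1 - x k) + delta k.-1 - mu *: xs.

End Algorithm.

(* Main.v *)
(* Write D = x^k - x^*, h = A D, t = theta(omega) and a = theta(h - omega).  Optimality
   of x^k in the convex subproblem, tested at x^*, gives
     a - t + mu |D|^2 <= <xi, D> + lambda sum_i v_i (|x^*_{J_i}| - |x^k_{J_i}|) =: E.
   As |a - t| <= L |h| and v >= 1/2 outside S^{k-1}, the lower bound on lambda puts D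
   in the cone and bounds L |h| + E by the blocks of D indexed by S^{k-1}.  Strong
   convexity of theta^2 at -omega gives a^2 - t^2 >= - 2 t L |h| + rhobar/2 |h|^2.
   Adding this to 2 t times the first inequality leaves
     2 mu t |D|^2 + rhobar/2 |h|^2 <= (a - t)^2 + 2 t (L |h| + E),
   in which restricted strong convexity bounds |h|^2 from below; (a - t)^2 <= L^2 |h|^2
   accounts for the term subtracted in d2. *)
Require Import Defs.
From HB Require Import structures.
From mathcomp Require Import all_boot all_order all_algebra.
From mathcomp Require Import all_classical all_reals all_analysis.
From mathcomp Require Import ring lra.

Set Implicit Arguments.
Unset Strict Implicit.
Unset Printing Implicit Defensive.

Import Order.TTheory GRing.Theory Num.Theory.
Import numFieldNormedType.Exports.

Local Open Scope classical_set_scope.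
Local Open Scope ring_scope.

(** * Euclidean inner product, Euclidean norm and spectral norm *)

Section EuclideanNorm.
Context {R : realType}.

Lemma dotvC d (u v : 'cV[R]_d) : dotv u v = dotv v u.
Proof. by apply: eq_bigr => i _; rewrite mulrC. Qed.

Lemma dotvDl d (u v w : 'cV[R]_d) : dotv (u + v) w = dotv u w + dotv v w.
Proof. by rewrite -big_split; apply: eq_bigr => i _; rewrite mxE mulrDl. Qed.

Lemma dotvDr d (u v w : 'cV[R]_d) : dotv u (v + w) = dotv u v + dotv u w.
Proof. by rewrite dotvC dotvDl !(dotvC u). Qed.

Lemma dotvZl d a (u v : 'cV[R]_d) : dotv (a *: u) v = a * dotv u v.
Proof. by rewrite mulr_sumr; apply: eq_bigr => i _; rewrite mxE mulrA. Qed.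

Lemma dotvZr d a (u v : 'cV[R]_d) : dotv u (a *: v) = a * dotv u v.
Proof. by rewrite dotvC dotvZl dotvC. Qed.

Lemma dotvNl d (u v : 'cV[R]_d) : dotv (- u) v = - dotv u v.
Proof. by rewrite -scaleN1r dotvZl mulN1r. Qed.

Lemma dotvNr d (u v : 'cV[R]_d) : dotv u (- v) = - dotv u v.
Proof. by rewrite dotvC dotvNl dotvC. Qed.

Lemma dotvv_ge0 d (u : 'cV[R]_d) : 0 <= dotv u u.
Proof. by apply: sumr_ge0 => i _; rewrite -expr2 sqr_ge0. Qed.

Lemma dotv_trmx d1 d2 (M : 'M[R]_(d1, d2)) u v :
  dotv u (M *m v) = dotv (M^T *m u) v.
Proof.
rewrite /dotv; under eq_bigr do rewrite mxE mulr_sumr.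
rewrite exchange_big; apply: eq_bigr => j _.
by rewrite mxE mulr_suml; apply: eq_bigr => i _; rewrite mxE mulrCA mulrA.
Qed.

Lemma enorm_ge0 d (u : 'cV[R]_d) : 0 <= enorm u.
Proof. exact: sqrtr_ge0. Qed.
Hint Resolve enorm_ge0 : core.

Lemma sqr_enorm d (u : 'cV[R]_d) : enorm u ^+ 2 = dotv u u.
Proof. by rewrite sqr_sqrtr // dotvv_ge0. Qed.

Lemma enorm_eq0 d (u : 'cV[R]_d) : enorm u = 0 -> u = 0.
Proof.
move=> u0; have /eqP : dotv u u = 0 by rewrite -sqr_enorm u0 expr0n.
rewrite psumr_eq0 => [/allP h|i _]; last by rewrite -expr2 sqr_ge0.
apply/matrixP => i j; rewrite (ord1 j) mxE.
by have := h i (mem_index_enum _); rewrite /= -expr2 sqrf_eq0 => /eqP.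
Qed.

Lemma dotv0l d (v : 'cV[R]_d) : dotv 0 v = 0.
Proof. by rewrite -(scale0r 0) dotvZl mul0r. Qed.

Lemma enorm0 d : enorm (0 : 'cV[R]_d) = 0.
Proof. by rewrite /enorm dotv0l sqrtr0. Qed.

(** Cauchy-Schwarz, by expanding the squared norm of |v| u - |u| v; dividing out 2 |u| |v| requires
    both vectors to be nonzero. *)
Lemma dotv_le_enorm d (u v : 'cV[R]_d) : dotv u v <= enorm u * enorm v.
Proof.
have [/enorm_eq0 ->|u0] := eqVneq (enorm u) 0; first by rewrite dotv0l enorm0 mul0r.
have [/enorm_eq0 ->|v0] := eqVneq (enorm v) 0.
  by rewrite dotvC dotv0l enorm0 mulr0.
have up : 0 < enorm u by rewrite lt_neqAle eq_sym u0 /=.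
have vp : 0 < enorm v by rewrite lt_neqAle eq_sym v0 /=.
have := dotvv_ge0 (enorm v *: u - enorm u *: v).
rewrite !(dotvDl, dotvDr, dotvNl, dotvNr, dotvZl, dotvZr) (dotvC v u) -!sqr_enorm.
move=> h; have : 0 <= 2 * (enorm u * enorm v) * (enorm u * enorm v - dotv u v).
  by move: h; lra.
by rewrite pmulr_rge0 ?subr_ge0 // !mulr_gt0.
Qed.

Lemma ler_enormD d (u v : 'cV[R]_d) : enorm (u + v) <= enorm u + enorm v.
Proof.
rewrite -(@ler_pXn2r _ 2) ?nnegrE ?addr_ge0 // sqrrD !sqr_enorm.
rewrite dotvDl !dotvDr (dotvC v u).
have := dotv_le_enorm u v; lra.
Qed.

Lemma enormZ d a (u : 'cV[R]_d) : enorm (a *: u) = `|a| * enorm u.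
Proof. by rewrite /enorm dotvZl dotvZr mulrA -expr2 sqrtrM ?sqr_ge0 // sqrtr_sqr. Qed.

Lemma enormN d (u : 'cV[R]_d) : enorm (- u) = enorm u.
Proof. by rewrite -scaleN1r enormZ normrN1 mul1r. Qed.

Lemma ler_enorm_sum (I : finType) d (F : I -> 'cV[R]_d) :
  enorm (\sum_i F i) <= \sum_i enorm (F i).
Proof.
apply: (big_ind2 (fun u a => enorm u <= a)); rewrite ?enorm0 //.
by move=> u a v b ua vb; exact: le_trans (ler_enormD _ _) (lerD _ _).
Qed.

(** The cross terms in the square of the sum are products of nonnegative numbers; the induction
    carries nonnegativity of the partial sums along. *)
Lemma ler_sum_sqr (I : finType) (P : pred I) (F : I -> R) :
  (forall i, 0 <= F i) ->
  \sum_(i | P i) F i ^+ 2 <= (\sum_(i | P i) F i) ^+ 2.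
Proof.
move=> F0; suff [] : 0 <= \sum_(i | P i) F i /\
  \sum_(i | P i) F i ^+ 2 <= (\sum_(i | P i) F i) ^+ 2 by [].
apply: (big_ind2 (fun a b => 0 <= a /\ b <= a ^+ 2)); rewrite ?expr0n //=.
move=> a b a' b' [a0 ba] [a0' ba']; split; first exact: addr_ge0.
have := mulr_ge0 a0 a0'; rewrite sqrrD; lra.
Qed.

(** This makes [specnorm] a true supremum. On the unit ball M u combines the columns of M with
    coefficients of modulus at most 1, so the sum of the column norms is a bound. *)
Lemma specnorm_has_sup d1 d2 (M : 'M[R]_(d1, d2)) :
  has_sup [set enorm (M *m u) | u in [set u : 'cV[R]_d2 | enorm u <= 1]].
Proof.
split; first by exists (enorm (M *m 0)); exists 0; rewrite //= enorm0 ler01.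
exists (\sum_j enorm (col j M)) => _ [u /= u1 <-].
have -> : M *m u = \sum_j u j 0 *: col j M.
  apply/matrixP => i j; rewrite (ord1 j) mxE summxE.
  by apply: eq_bigr => l _; rewrite !mxE mulrC.
apply: le_trans (ler_enorm_sum _) _; apply: ler_sum => j _.
rewrite enormZ ler_piMl //; apply: le_trans u1.
rewrite -(@ler_pXn2r _ 2) ?nnegrE // sqr_enorm real_normK ?num_real //.
rewrite /dotv (bigD1 j) //= expr2 lerDl sumr_ge0 // => i _.
by rewrite -expr2 sqr_ge0.
Qed.

Lemma specnorm_ge0 d1 d2 (M : 'M[R]_(d1, d2)) : 0 <= specnorm M.
Proof.
have := specnorm_has_sup M; move=> [_ /ub_le_sup]; apply.
by exists 0; rewrite /= ?enorm0 ?ler01 // mulmx0 enorm0.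
Qed.

Lemma ler_specnorm d1 d2 (M : 'M[R]_(d1, d2)) u :
  enorm (M *m u) <= specnorm M * enorm u.
Proof.
have [/enorm_eq0 ->|u0] := eqVneq (enorm u) 0; first by rewrite mulmx0 !enorm0 mulr0.
have up : 0 < enorm u by rewrite lt_neqAle eq_sym u0 /=.
rewrite -ler_pdivrMr // mulrC -{1}(gtr0_norm (_ : 0 < (enorm u)^-1)) ?invr_gt0 //.
rewrite -enormZ scalemxAr.
have [_ /ub_le_sup] := specnorm_has_sup M; apply.
by exists ((enorm u)^-1 *: u) => //=; rewrite enormZ gtr0_norm ?invr_gt0 // mulVf.
Qed.

End EuclideanNorm.

#[local] Hint Extern 0 (is_true (0 <= enorm _)) => exact: enorm_ge0 : core.
#[local] Hint Extern 0 (is_true (0 <= specnorm _)) => exact: specnorm_ge0 : core.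

(** * The weights produced by the conjugate of [psi] lie in [0, 1] *)

Section Conjugate.
Context {R : realType}.

(* Where f is not differentiable, derive1 takes the junk value 0. *)
Lemma derive1_itv01 (f : R -> R) (a : R) :
  (forall s t, s <= t -> 0 <= f t - f s <= t - s) -> 0 <= derive1 f a <= 1.
Proof.
move=> f01; set q := fun h : R => h^-1 *: (f (h + a) - f a).
have q01 h : h != 0 -> 0 <= q h <= 1.
  rewrite /q /GRing.scale /=; case: (ltgtP h 0) => // h0 _.
    have /f01 : h + a <= a by lra.
    move=> /andP[u v]; apply/andP; split.
      by rewrite mulr_le0 ?invr_le0 ?(ltW h0) //; lra.
    by rewrite ler_ndivrMl //; lra.
  have /f01 : a <= h + a by lra.
  have -> : h + a - a = h by ring.
  move=> /andP[u v]; rewrite mulr_ge0 ?invr_ge0 //=; last exact: ltW.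
  by rewrite mulrC ler_pdivrMr ?mul1r.
have [cq|] := pselect (cvg (q @ 0^')); last first.
  by move=> /dvgP; rewrite /derive1 => ->; rewrite lexx ler01.
apply/andP; split.
  apply: limr_ge => //; near=> h.
  by have /q01/andP[] : h != 0 by near: h; exact: nbhs_dnbhs_neq.
apply: limr_le => //; near=> h.
by have /q01/andP[] : h != 0 by near: h; exact: nbhs_dnbhs_neq.
Unshelve. all: by end_near.
Qed.

Lemma class_L_ge0 (phi : R -> \bar R) : class_L phi ->
  forall t, 0 <= t <= 1 -> (0 <= phi t)%E.
Proof. by case=> _ _ _ _ _ _ [ts [_ h] <-] t /h. Qed.

(** The conjugate is a supremum over t in [0, 1] of the affine functions s t - phi(t). All slopes
    lie in [0, 1], so it is nondecreasing and 1-Lipschitz. *)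
Lemma dpsi_star_itv01 (phi : R -> \bar R) (s : R) :
  class_L phi -> 0 <= dpsi_star phi s <= 1.
Proof.
move=> Lphi; set F := conjugate (psi phi).
(* Off [0, 1] [psi] is +oo, so those t contribute -oo to the supremum. *)
have ub y z : (forall t, 0 <= t <= 1 -> ((y * t)%:E - phi t <= z)%E) -> (F y <= z)%E.
  move=> h; apply: ge_ereal_sup => _ [t _ <-]; rewrite /psi.
  by case: ifPn => [/h //|_]; rewrite addeNy leNye.
have lb y t : 0 <= t <= 1 -> ((y * t)%:E - phi t <= F y)%E.
  by move=> t01; apply: ereal_sup_ubound; exists t => //; rewrite /psi t01.
(* Finiteness: t = 1, where [phi] equals 1, gives the lower bound y - 1, and [phi >= 0] on [0, 1]
   gives the upper bound |y|. *)
have Ffin y : F y \is a fin_num.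
  rewrite fin_numE -ltey -ltNye; apply/andP; split.
    apply: lt_le_trans (lb y 1 _); last by rewrite ler01 lexx.
    by rewrite (L_at1 Lphi) -EFinB ltNyr.
  apply: le_lt_trans (ltry `|y|); apply: ub => t t01.
  rewrite -[leRHS]sube0; apply: leeB; last exact: (class_L_ge0 Lphi).
  rewrite lee_fin; case/andP: t01 => t0 t1; apply: le_trans (ler_norm _) _.
  by rewrite normrM (ger0_norm t0) ler_piMr.
apply: derive1_itv01 => x y xy; apply/andP; split.
  rewrite subr_ge0 fine_le //; apply: ub => t t01.
  apply: le_trans (lb y t t01); apply: leeB => //.
  by rewrite lee_fin ler_wpM2r //; case/andP: t01.
rewrite lerBlDr -lee_fin EFinD !fineK //; apply: ub => t t01.
apply: (@le_trans _ _ ((y - x)%:E + ((x * t)%:E - phi t))%E); last first.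
  by apply: leeD => //; exact: lb.
rewrite addeA -EFinD; apply: leeB => //; rewrite lee_fin.
case/andP: t01 => t0 t1; nra.
Qed.

End Conjugate.

(** * Decomposition along the blocks and the mixed block norms *)

Section Blocks.
Context {R : realType} {p m : nat} (J : 'I_m -> {set 'I_p}).
Hypothesis J_partition : block_partition J.

Lemma sum_blocks (V : nmodType) (f : 'I_p -> V) :
  \sum_j f j = \sum_i \sum_(k < #|J i|) f (enum_val k).
Proof.
have [Jinj Jpart] := J_partition.
transitivity (\sum_(j in finset.setTfor 'I_p) f j).
  by apply: eq_bigl => j; rewrite inE.
(* Injectivity of [J] turns the sum over the set of blocks into a sum over their indices. *)
rewrite (set_partition_big _ Jpart) big_imset /=; last by move=> i j _ _; exact: Jinj.
rewrite big_mkcond /=; apply: eq_bigr => i _; rewrite inE.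
by rewrite [LHS]big_enum_val.
Qed.

Lemma dotv_blocks (u v : 'cV[R]_p) :
  dotv u v = \sum_i dotv (subvec (J i) u) (subvec (J i) v).
Proof.
rewrite /dotv sum_blocks; apply: eq_bigr => i _.
by apply: eq_bigr => k _; rewrite !mxE.
Qed.

Lemma mulmx_blocks n (A : 'M[R]_(n, p)) (u : 'cV[R]_p) :
  A *m u = \sum_i subcols (J i) A *m subvec (J i) u.
Proof.
apply/matrixP => a b; rewrite mxE sum_blocks summxE; apply: eq_bigr => i _.
by rewrite mxE; apply: eq_bigr => k _; rewrite !mxE.
Qed.

Lemma enorm_le_sum_blocks (u : 'cV[R]_p) :
  enorm u <= \sum_i enorm (subvec (J i) u).
Proof.
have F0 : 0 <= \sum_i enorm (subvec (J i) u) by exact: sumr_ge0.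
rewrite -(@ler_pXn2r _ 2) ?nnegrE //.
rewrite sqr_enorm dotv_blocks; under eq_bigr do rewrite -sqr_enorm.
exact: ler_sum_sqr.
Qed.

(** Cauchy-Schwarz against the all-ones vector on [S], obtained from the nonnegativity of the
    variance of the block norms. *)
Lemma sum_blocks_le_enorm (S : {set 'I_m}) (u : 'cV[R]_p) :
  \sum_(i in S) enorm (subvec (J i) u) <= Num.sqrt #|S|%:R * enorm u.
Proof.
set F := fun i => enorm (subvec (J i) u).
have [->|S0] := eqVneq S finset.set0; first by rewrite big_set0 mulr_ge0 ?sqrtr_ge0.
have cS : 0 < #|S|%:R :> R by rewrite ltr0n card_gt0.
have s0 : 0 < Num.sqrt #|S|%:R :> R by rewrite sqrtr_gt0.
(* The mean of the block norms over [S]. *)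
set t := (\sum_(i in S) F i) / #|S|%:R.
have F0 : 0 <= \sum_(i in S) F i by apply: sumr_ge0 => i _; exact: enorm_ge0.
rewrite -(@ler_pXn2r _ 2) ?nnegrE ?mulr_ge0 ?sqrtr_ge0 //.
have FS : \sum_(i in S) F i ^+ 2 <= enorm u ^+ 2.
  rewrite sqr_enorm dotv_blocks big_mkcond; apply: ler_sum => i _.
  by case: ifP => _; rewrite ?dotvv_ge0 // sqr_enorm.
rewrite exprMn sqr_sqrtr ?ler0n //.
apply: le_trans (ler_wpM2l (ltW cS) FS).
have : 0 <= \sum_(i in S) (F i - t) ^+ 2 by apply: sumr_ge0 => i _; exact: sqr_ge0.
have -> : \sum_(i in S) (F i - t) ^+ 2 =
    \sum_(i in S) F i ^+ 2 - 2 * t * (\sum_(i in S) F i) + #|S|%:R * t ^+ 2.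
  transitivity (\sum_(i in S) (F i ^+ 2 + - (2 * t) * F i + t ^+ 2)).
    by apply: eq_bigr => i _; ring.
  by rewrite !big_split /= -mulr_sumr sumr_const -[t ^+ 2 *+ _]mulr_natl; ring.
rewrite /t => h; rewrite -subr_ge0.
have -> : #|S|%:R * (\sum_(i in S) F i ^+ 2) - (\sum_(i in S) F i) ^+ 2 =
  #|S|%:R * (\sum_(i in S) F i ^+ 2
     - 2 * ((\sum_(i in S) F i) / #|S|%:R) * (\sum_(i in S) F i)
     + #|S|%:R * ((\sum_(i in S) F i) / #|S|%:R) ^+ 2).
  by field; rewrite lt0r_neq0.
by rewrite mulr_ge0 // ltW.
Qed.

Lemma norm2inf_ge0 n (A : 'M[R]_(n, p)) : 0 <= norm2inf J A.
Proof. by rewrite /norm2inf; elim/big_ind: _ => // a b a0 b0; rewrite le_max a0. Qed.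

Lemma enorm_mulmx_blocks n (A : 'M[R]_(n, p)) (u : 'cV[R]_p) :
  enorm (A *m u) <= norm2inf J A * \sum_i enorm (subvec (J i) u).
Proof.
rewrite mulmx_blocks; apply: le_trans (ler_enorm_sum _) _.
rewrite mulr_sumr; apply: ler_sum => i _.
apply: le_trans (ler_specnorm _ _) _; apply: ler_wpM2r => //.
by rewrite /norm2inf (bigD1 i) //= le_max lexx.
Qed.

Lemma ler_supnorm d (u : 'cV[R]_d) i : `|u i 0| <= supnorm u.
Proof. by rewrite /supnorm mx_normrE (bigD1 (i, 0)) //= le_max lexx. Qed.

Lemma supnorm_le d (u : 'cV[R]_d) a :
  0 <= a -> (forall i, `|u i 0| <= a) -> supnorm u <= a.
Proof.
move=> a0 ua; rewrite /supnorm mx_normrE; elim/big_ind: _ => //.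
  by move=> x y xa ya; rewrite ge_max xa.
by move=> [i j] _ /=; rewrite (ord1 j).
Qed.

Lemma supnorm_ge0 d (u : 'cV[R]_d) : 0 <= supnorm u.
Proof. by rewrite /supnorm mx_normrE; elim/big_ind: _ => // a b a0 b0; rewrite le_max a0. Qed.

Lemma ler_supnorm_subvec d (I : {set 'I_d}) (u : 'cV[R]_d) i :
  i \in I -> `|u i 0| <= supnorm (subvec I u).
Proof. by move=> iI; have := ler_supnorm (subvec I u) (enum_rank_in iI i);
  rewrite mxE enum_rankK_in. Qed.

Lemma dotv_le_blocks (u v : 'cV[R]_p) :
  dotv u v <= supnorm (G J u) * \sum_i enorm (subvec (J i) v).
Proof.
rewrite dotv_blocks mulr_sumr; apply: ler_sum => i _.
apply: le_trans (dotv_le_enorm _ _) _; apply: ler_wpM2r => //.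
by apply: le_trans (ler_supnorm (G J u) i); rewrite mxE ler_norm.
Qed.

Lemma subvecD d (I : {set 'I_d}) (u v : 'cV[R]_d) :
  subvec I (u + v) = subvec I u + subvec I v.
Proof. by apply/matrixP => i j; rewrite !mxE. Qed.

Lemma subvecZ d (I : {set 'I_d}) a (u : 'cV[R]_d) : subvec I (a *: u) = a *: subvec I u.
Proof. by apply/matrixP => i j; rewrite !mxE. Qed.

Lemma subvecB d (I : {set 'I_d}) (u v : 'cV[R]_d) :
  subvec I (u - v) = subvec I u - subvec I v.
Proof. by apply/matrixP => i j; rewrite !mxE. Qed.

End Blocks.

(** * Convexity along segments and first-order inequalities *)

Section Optimality.
Context {R : realType}.

(** Plays the part of the limit s -> 0 in first-order arguments. If a < 0, then s = 1 gives b >= -a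
    > 0, and s = -a / (2b - a) yields the negative value a (b - a) / (2b - a). *)
Lemma ge0_of_segment (a b : R) :
  (forall s, 0 < s <= 1 -> 0 <= a + s * b) -> 0 <= a.
Proof.
move=> h; rewrite leNgt; apply/negP => a0.
have b0 : 0 < b by have := h 1; rewrite ltr01 lexx mul1r => /(_ isT); lra.
have s0 : 0 < - a / (2 * b - a) by rewrite divr_gt0 //; lra.
have s1 : - a / (2 * b - a) <= 1 by rewrite ler_pdivrMr; lra.
have := h _ (introT andP (conj s0 s1)).
have -> : a + - a / (2 * b - a) * b = a * (b - a) / (2 * b - a).
  by field; apply: lt0r_neq0; lra.
rewrite pmulr_lge0 ?invr_gt0; last lra.
rewrite nmulr_rge0 //; lra.
Qed.

Lemma convex_setP d (X : set 'cV[R]_d) u v s : convex_set X ->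
  X u -> X v -> 0 <= s <= 1 -> X (u + s *: (v - u)).
Proof.
move=> cX Xu Xv /andP[s0 s1].
have := cX v u (Itv01 s0 s1) (mem_set Xv) (mem_set Xu) => /set_mem.
rewrite /conv /= /unstable.onem.
by congr X; rewrite scalerBr scalerBl scale1r addrC -!addrA; congr (_ + _); rewrite addrC.
Qed.

Lemma convex_functionP d (f : 'cV[R]_d -> R) u v s :
  convex_function setT (f : 'cV[R]_d -> R^o) -> 0 <= s <= 1 ->
  f (u + s *: (v - u)) <= (1 - s) * f u + s * f v.
Proof.
move=> cf /andP[s0 s1].
have := cf (Itv01 s0 s1) v u (mem_set I) (mem_set I).
rewrite convRE /conv /= /unstable.onem [s * _ + _]addrC.
apply: le_trans; rewrite le_eqVlt; apply/orP; left; apply/eqP; congr f.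
by rewrite scalerBr scalerBl scale1r addrC -!addrA; congr (_ + _); rewrite addrC.
Qed.

(* The one-sided Lipschitz bound stands in for a subgradient of theta at u; it
   enters through theta(y)^2 >= theta(u)^2 + 2 theta(u) (theta(y) - theta(u)). *)
Lemma sq_sconvex_lower_bound d (theta : 'cV[R]_d -> R) (L rhobar : R) (u h : 'cV[R]_d) :
  convex_function setT
    ((fun u => theta u ^+ 2 - rhobar / 2 * enorm u ^+ 2) : 'cV[R]_d -> R^o) ->
  0 <= theta u ->
  (forall s, 0 <= s <= 1 -> theta u - s * (L * enorm h) <= theta (u + s *: h)) ->
  theta u ^+ 2 - 2 * theta u * (L * enorm h) + rhobar / 2 * enorm h ^+ 2
    <= theta (u + h) ^+ 2.
Proof.
move=> cf tu0 lip; rewrite -subr_ge0.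
(* Strong convexity gains s (1 - s) rhobar/2 |h|^2 on the segment; after division by [s], this is
   the part that still carries a factor [s]. *)
apply: (@ge0_of_segment _ (rhobar / 2 * enorm h ^+ 2)) => s /andP[s0 s1].
have s01 : 0 <= s <= 1 by rewrite ltW.
have := convex_functionP u (u + h) cf s01.
rewrite [u + h - u]addrC addKr !sqr_enorm !(dotvDl, dotvDr, dotvZl, dotvZr) (dotvC h u).
have := mulr_ge0 tu0 (_ : 0 <= theta (u + s *: h) - (theta u - s * (L * enorm h))).
rewrite subr_ge0 => /(_ (lip s s01)).
have := sqr_ge0 (theta (u + s *: h) - theta u).
set t := theta u; set y := theta (u + s *: h); set a := theta (u + h).
set N := L * enorm h; set hh := dotv h h; set uh := dotv u h.
move=> k1 k2 k3; rewrite -(pmulr_rge0 _ s0).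
move: k1 k2 k3; rewrite !expr2; lra.
Qed.

End Optimality.

(** * Optimality condition of the convex subproblem *)

Section Subproblem.
Context {R : realType} {n p m : nat} (A : 'M[R]_(n, p)) (b : 'cV[R]_n).
Variables (X : set 'cV[R]_p) (J : 'I_m -> {set 'I_p}) (theta : 'cV[R]_n -> R).

Lemma Qmx_sym (g1 g2 : R) : (Qmx A g1 g2)^T = Qmx A g1 g2.
Proof. by rewrite /Qmx linearD /= tr_scalar_mx linearZ /= trmx_mul trmxK. Qed.

Lemma dotv_G_segment (v : 'cV[R]_m) (u w : 'cV[R]_p) (s : R) :
  (forall i, 0 <= v i 0) -> 0 <= s <= 1 ->
  dotv v (G J (u + s *: (w - u))) <= (1 - s) * dotv v (G J u) + s * dotv v (G J w).
Proof.
move=> v0 /andP[s0 s1]; rewrite /dotv !mulr_sumr -big_split /=.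
apply: ler_sum => i _; rewrite !mxE.
have -> : u + s *: (w - u) = (1 - s) *: u + s *: w.
  by apply/matrixP => a c; rewrite !mxE; ring.
rewrite subvecD !subvecZ.
have := ler_enormD ((1 - s) *: subvec (J i) u) (s *: subvec (J i) w).
rewrite !enormZ (ger0_norm s0) ger0_norm ?subr_ge0 // => h.
have := ler_wpM2l (v0 i) h; lra.
Qed.

(* The variational inequality of the convex subproblem, with the smooth terms
   linearized at the minimizer z. *)
Lemma sub_obj_optimality (mu lambda : R) (v : 'cV[R]_m) (Q : 'M[R]_p)
    (xk dk z y : 'cV[R]_p) :
  convex_set X -> convex_function setT (theta : 'cV[R]_n -> R^o) ->
  0 <= lambda -> (forall i, 0 <= v i 0) -> Q^T = Q ->
  argmin X (sub_obj A b J theta mu lambda v Q xk dk) z -> X y ->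
  theta (A *m z - b) + lambda * dotv v (G J z)
    + dotv (Q *m (xk - z) + dk - mu *: z) (y - z)
  <= theta (A *m y - b) + lambda * dotv v (G J y).
Proof.
move=> cX cth l0 v0 Qs [Xz zmin] Xy; rewrite -subr_ge0.
set e := y - z.
(* Minimality of [z] against [z + s *: e], divided by [s], leaves the first-order terms plus [s]
   times this quadratic remainder. *)
apply: (@ge0_of_segment _ _ (mu / 2 * dotv e e + 2^-1 * dotv e (Q *m e))) => s /andP[s0 s1].
have s01 : 0 <= s <= 1 by rewrite ltW.
have := zmin _ (convex_setP cX Xz Xy s01).
have := convex_functionP (A *m z - b) (A *m y - b) cth s01.
have -> : A *m z - b + s *: (A *m y - b - (A *m z - b)) = A *m (z + s *: e) - b.
  rewrite mulmxDr -scalemxAr mulmxBr addrAC; congr (_ + _ *: _ + _).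
  by rewrite opprB addrA subrK.
have := ler_wpM2l l0 (dotv_G_segment z y v0 s01).
rewrite -/e /sub_obj /sqnormM.
have -> : z + s *: e - xk = s *: e + (z - xk) by rewrite addrCA addrA addrC addrA.
have -> : xk - z = - (z - xk) by rewrite opprB.
set f := z - xk; set ze := z + s *: e; clearbody e f.
have sz : enorm ze ^+ 2 = enorm z ^+ 2 + 2 * s * dotv z e + s ^+ 2 * dotv e e.
  rewrite !sqr_enorm /ze !(dotvDl, dotvDr, dotvZl, dotvZr) (dotvC e z); ring.
(* Symmetry of [Q] merges the two cross terms of the proximal quadratic. *)
have sQ : dotv f (Q *m e) = dotv e (Q *m f) by rewrite dotv_trmx Qs dotvC.
rewrite sz !mulmxDr -!scalemxAr mulmxN.
rewrite !(dotvDl, dotvDr, dotvZl, dotvZr, dotvNl, dotvNr) sQ (dotvC (Q *m f)).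
move=> k1 k2 k3; rewrite -(pmulr_rge0 _ s0).
move: k1 k2 k3; rewrite !expr2; lra.
Qed.

End Subproblem.

(** * Nonnegativity of the loss and the scalar inequalities behind the bound *)

Lemma loss_theta_ge0 (R : realType) n p (A : 'M[R]_(n, p)) b X theta L rhobar u :
  loss_assumption A b X theta L rhobar -> 0 <= theta u.
Proof.
(* Subadditivity at (0, 0) gives theta(0) >= 0; at (u, -u), with evenness, it gives theta(0) <= 2
   theta(u). *)
move=> h; have := loss_subadd h 0 0; have := loss_subadd h u (- u).
rewrite addr0 subrr (loss_even h); lra.
Qed.

(* In \bar R the inverse of 0 is +oo, so d = 0 forces 0 < a. *)
Lemma lt_div_cross (R : realType) (l a d : R) : 0 < l -> 0 <= d ->
  (l%:E < a%:E / d%:E)%E -> l * d < a.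
Proof.
move=> l0; rewrite le_eqVlt inver => /predU1P[<-|d0].
  rewrite eqxx mulr0 => h; have : (0 < a%:E * +oo)%E by rewrite (lt_trans _ h) ?lte_fin.
  by case: (ltgtP 0 a) => // [a0|<-]; rewrite ?mul0e ?ltxx // lt0_muley ?lte_fin.
by rewrite gt_eqF // -EFinM lte_fin ltr_pdivlMr.
Qed.

(** The final computation in real numbers. [P] and [N] stand for the sums of block norms of x^k -
    x^* inside and outside S^{k-1}, [D] for its norm, [dn] for L |h|, [rho'] for n kappa rhobar, [s]
    and [sq] for |S^{k-1}| and its root. The aim is d2 D^2 <= d1 D. *)
Lemma error_bound_arith (R : realType)
    (LA Gxi lambda vS c P N D t a dn LN mu rho' s sq : R) :
  let B := LA + Gxi + lambda * vS in
  let q := 3 * c / (c - 2) * LN in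
  2 < c -> 0 <= LA -> 0 <= Gxi -> 0 < lambda -> 0 <= vS -> 0 <= LN ->
  0 <= P -> 0 <= N -> 0 <= D -> 0 <= t -> 0 <= sq -> sq <= s ->
  D <= P + N -> P <= sq * D -> 0 <= dn ->
  N <= 2 * (c + 1) / (c - 2) * P ->
  c * (Gxi + 2 * LA) <= lambda ->
  `|a - t| <= dn -> dn <= LA * D -> dn <= LN * (P + N) ->
  a - t + mu * D ^+ 2 <= Gxi * (P + N) + lambda * (vS * P - N / 2) ->
  t ^+ 2 - 2 * t * dn + rho' * D ^+ 2 <= a ^+ 2 ->
  0 < 2 * mu * t + rho' - q * B * s ->
  D <= (2 * t * B * sq) / (2 * mu * t + rho' - q * B * s).
Proof.
move=> B q c2 LA0 G0 l0 vS0 LN0 P0 N0 D0 t0 sq0 sqs DT PD dn0 cone lc atd dLA dLN opt scv d2.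
have lvS : 0 <= lambda * vS by rewrite mulr_ge0 // ltW.
have B0 : 0 <= B by rewrite /B; lra.
have cm2 : 0 < c - 2 by lra.
(* The factor 3c / (c - 2) is 1 plus the cone constant. *)
have TP : P + N <= 3 * c / (c - 2) * P.
  have -> : 3 * c / (c - 2) = 1 + 2 * (c + 1) / (c - 2) by field; rewrite lt0r_neq0.
  by rewrite mulrDl mul1r lerD2l.
have l2 : 2 * (Gxi + 2 * LA) <= lambda.
  by apply: le_trans lc; apply: ler_wpM2r; lra.
(* The coefficient of [N] is LA + Gxi - lambda/2, which is nonpositive, so only [P] survives. *)
have dE : dn + (Gxi * (P + N) + lambda * (vS * P - N / 2)) <= B * P.
  have := ler_wpM2l LA0 DT.
  have : 0 <= N * (lambda / 2 - LA - Gxi) by apply: mulr_ge0 => //; lra.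
  rewrite /B; lra.
have q0 : 0 <= q by rewrite /q mulr_ge0 // divr_ge0 //; lra.
have qP : dn <= q * (sq * D).
  apply: le_trans dLN _; apply: le_trans (ler_wpM2l LN0 TP) _.
  have -> : LN * (3 * c / (c - 2) * P) = q * P by rewrite /q; ring.
  exact: ler_wpM2l.
(* The two bounds on [dn], through the spectral norm and through the block norms, are multiplied;
   then LA <= B and sq <= s. *)
have dn2 : dn ^+ 2 <= q * B * s * D ^+ 2.
  have : dn * dn <= LA * D * (q * (sq * D)) by apply: ler_pM.
  have : LA * D * (q * (sq * D)) <= B * D * (q * (s * D)).
    have sqD0 : 0 <= sq * D by exact: mulr_ge0.
    apply: ler_pM; [exact: mulr_ge0|exact: mulr_ge0| |].
      by apply: ler_wpM2r => //; rewrite /B; lra.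
    by apply: ler_wpM2l => //; apply: ler_wpM2r.
  rewrite !expr2; lra.
have at2 : (a - t) ^+ 2 <= dn ^+ 2.
  by rewrite -real_normK ?num_real // ler_pXn2r ?nnegrE.
have tdE := ler_wpM2l t0 (le_trans (lerD (lexx dn) opt) dE).
have tBP := ler_wpM2l (mulr_ge0 t0 B0) PD.
rewrite ler_pdivlMr //.
have [->|Dn0] := eqVneq D 0; first by rewrite mul0r !mulr_ge0.
have Dp : 0 < D by rewrite lt_neqAle eq_sym Dn0.
(* One factor [D] is restored, since the collected inequalities are quadratic in [D]. *)
rewrite -(ler_pM2r Dp).
move: dn2 at2 tdE tBP scv; rewrite !expr2; lra.
Qed.

(** * Error bound for the iterate x^k *)

Theorem theorem2 (R : realType) (n p m : nat)
    (A : 'M[R]_(n, p)) (b omega : 'cV[R]_n) (xs : 'cV[R]_p)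
    (X : set 'cV[R]_p) (J : 'I_m -> {set 'I_p})
    (theta : 'cV[R]_n -> R) (L rhobar : R)
    (phi : R -> \bar R) (mu nu rho varrho lambda lg1 lg2 : R)
    (g1 g2 : nat -> R) (delta x : nat -> 'cV[R]_p)
    (c kappa : R) (k : nat)
    (X_nonempty : X !=set0) (X_closed : closed X) (X_convex : convex_set X)
    (J_partition : block_partition J)
    (xs_X : X xs) (obs : b = A *m xs + omega)
    (theta_loss : loss_assumption A b X theta L rhobar)
    (x_pmm : inexact_pmm A b X J theta phi mu nu rho varrho lambda lg1 lg2
               g1 g2 delta x)
    (c_gt2 : 2 < c) (k_ge1 : (1 <= k)%N) :
  let Sbar := bsupp J xs in
  let Sk := bsupp J (x k.-1) in
  let w := wvec phi rho J (x k.-1) in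
  let vS := supnorm (subvec Sbar (vvec phi rho J (x k.-1))) in
  let Gxi := supnorm (G J (xi_vec A mu g1 g2 delta x xs k)) in
  let LA := L * specnorm A in
  let q := 3 * c / (c - 2) * L * norm2inf J A in
  let d1 := 2 * theta omega * (LA + Gxi + lambda * vS) * Num.sqrt #|Sk|%:R in
  let d2 := 2 * mu * theta omega + n%:R * kappa * rhobar
            - q * (LA + Gxi + lambda * vS) * #|Sk|%:R in
  0 < kappa ->
  (forall y : 'cV[R]_p, cone J c Sbar (3 / 2 * #|Sbar|%:R) y ->
     (2 * n%:R)^-1 * enorm (A *m y) ^+ 2 >= kappa * enorm y ^+ 2) ->
  Sbar \subset Sk ->
  #|Sk|%:R <= 3 / 2 * #|Sbar|%:R :> R ->
  \big[Num.max/0]_(i in ~: Sk) w i 0 <= 1 / 2 ->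
  c * (Gxi + 2 * LA) <= lambda ->
  (lambda%:E < (2 * mu * theta omega + n%:R * kappa * rhobar
                  - q * (LA + Gxi) * #|Sk|%:R)%:E
               / (q * vS * #|Sk|%:R)%:E)%E ->
  enorm (x k - xs) <= d1 / d2.
Proof.
move=> Sbar Sk w vS Gxi LA q d1 d2 kappa0 RE sub cardS wmax lam_ge lam_lt.
have [L0 rho0 cth csq] := And4 (loss_L_ge0 theta_loss) (loss_rhobar_gt0 theta_loss)
  (loss_convex theta_loss) (loss_sq_sconvex theta_loss).
have lam0 : 0 < lambda.
  rewrite (pmm_lambda x_pmm) mulr_gt0 ?(pmm_nu x_pmm) //.
  exact: lt_le_trans ltr01 (pmm_rho x_pmm).
set v := vvec phi rho J (x k.-1).
have w01 i : 0 <= w i 0 <= 1.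
  by rewrite mxE; apply: dpsi_star_itv01; case: (pmm_phi x_pmm).
have vE i : v i 0 = 1 - w i 0 by rewrite !mxE.
have v0 i : 0 <= v i 0 by rewrite vE; have := w01 i; lra.
have vS0 : 0 <= vS by exact: supnorm_ge0.
have vS1 : vS <= 1.
  apply: supnorm_le => // i; rewrite mxE ger0_norm ?v0 // -/v vE.
  by have := w01 (enum_val i); lra.
have v_out i : i \notin Sk -> 2^-1 <= v i 0.
  move=> iS; have : w i 0 <= 1 / 2.
    by apply: le_trans wmax; rewrite (bigD1 i) ?le_max ?lexx // inE.
  by rewrite vE; lra.
set D := x k - xs; set T := fun i => enorm (subvec (J i) D).
set P := \sum_(i in Sk) T i; set N := \sum_(i in ~: Sk) T i.
have T0 i : 0 <= T i by exact: enorm_ge0.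
have P0 : 0 <= P by apply: sumr_ge0.
have N0 : 0 <= N by apply: sumr_ge0.
have TPN : \sum_i T i = P + N.
  rewrite (bigID (mem Sk)) /=; congr (_ + _).
  by apply: eq_bigl => i; rewrite !inE.
set h := A *m D; set t := theta omega; set a := theta (A *m x k - b).
have t0 : 0 <= t by exact: loss_theta_ge0 theta_loss.
have xkX : X (x k).
  by have [] := pmm_step x_pmm k.-1; rewrite (prednK k_ge1).
have bE : A *m xs - b = - omega by rewrite obs opprD addrA subrr add0r.
have tE : theta (A *m xs - b) = t by rewrite bE (loss_even theta_loss).
have hE : A *m xs - b + h = A *m x k - b.
  by rewrite /h mulmxBr addrC addrA subrK.
have lip s : 0 <= s <= 1 -> `|theta (A *m xs - b + s *: h) - t| <= s * (L * enorm h).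
  move=> s01; have s0 : 0 <= s by case/andP: s01.
  (* Convexity of [X] keeps x^* + s D in [X], so the whole segment lies where [theta] is
     Lipschitz. *)
  rewrite -tE; apply: le_trans (loss_lipschitz theta_loss _ _) _.
  - exists (xs + s *: D); first exact: convex_setP.
    by rewrite mulmxDr -scalemxAr addrAC.
  - by exists xs.
  - by rewrite addrC addKr enormZ ger0_norm // mulrCA.
have lip1 : `|a - t| <= L * enorm h.
  by have := lip 1; rewrite scale1r hE mul1r; apply; rewrite ler01 lexx.
have scv : t ^+ 2 - 2 * t * (L * enorm h) + rhobar / 2 * enorm h ^+ 2 <= a ^+ 2.
  have := @sq_sconvex_lower_bound _ _ theta L rhobar (A *m xs - b) h csq.
  rewrite tE hE; apply => // s /lip; rewrite ler_norml; lra.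
have dLA : L * enorm h <= LA * enorm D by rewrite -mulrA ler_wpM2l // ler_specnorm.
have dLN : L * enorm h <= L * norm2inf J A * (P + N).
  by rewrite -mulrA ler_wpM2l // -TPN enorm_mulmx_blocks.
have DT : enorm D <= P + N by rewrite -TPN enorm_le_sum_blocks.
set xi := xi_vec A mu g1 g2 delta x xs k.
have opt : a - t + mu * enorm D ^+ 2 <= Gxi * (P + N) + lambda * (vS * P - N / 2).
  have := pmm_step x_pmm k.-1; rewrite (prednK k_ge1) => kmin.
  have := sub_obj_optimality X_convex cth (ltW lam0) v0 (Qmx_sym _ _ _) kmin xs_X.
  (* The linearization carries mu x^k while [xi] carries mu x^*; the difference mu D produces the
     term mu |D|^2. *)
  have -> : Qmx A (g1 k.-1) (g2 k.-1) *m (x k.-1 - x k) + delta k.-1 - mu *: x k =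
      xi - mu *: D.
    by apply/matrixP => i j; rewrite !mxE; ring.
  have -> : xs - x k = - D by rewrite opprB.
  rewrite tE -/a dotvDl !dotvNr dotvNl dotvZl -sqr_enorm.
  have := dotv_le_blocks J_partition xi D; rewrite TPN -/Gxi.
  have GE y i : G J y i 0 = enorm (subvec (J i) y) by rewrite mxE.
  have : dotv v (G J xs) - dotv v (G J (x k)) <= vS * P - N / 2.
    rewrite /dotv -sumrB (bigID (mem Sk)) /=; apply: lerD.
      rewrite mulr_sumr; apply: ler_sum => i iS; rewrite !GE -mulrBr.
      (* On [Sbar] the triangle inequality and v_i <= vS suffice; on the rest of [Sk] the block of
         [xs] vanishes and the term is nonpositive. *)
      have [iSb|] := boolP (i \in Sbar).
        apply: (@le_trans _ _ (v i 0 * T i)).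
          apply: ler_wpM2l => //.
          have := ler_enormD (subvec (J i) (x k)) (- subvec (J i) D).
          rewrite enormN -subvecB opprB addrCA subrr addr0 -/(T i); lra.
        by apply: ler_wpM2r => //; rewrite -[v i 0]ger0_norm // ler_supnorm_subvec.
      rewrite inE negbK => /eqP ->; rewrite enorm0 sub0r mulrN.
      by apply: (@le_trans _ _ 0); rewrite ?oppr_le0 mulr_ge0.
    rewrite mulrC mulr_sumr -sumrN.
    under [X in _ <= X]eq_bigl => i do rewrite inE.
    (* Off [Sk], hence off [Sbar], the block of [xs] is zero, so T i is the block norm of x^k and
       v_i >= 1/2 applies. *)
    apply: ler_sum => i iS; rewrite !GE -mulrBr.
    have : i \notin Sbar by apply: contra iS; exact: (fintype.subsetP sub).
    rewrite inE negbK => /eqP xsi.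
    by rewrite /T subvecB xsi subr0 enorm0 sub0r mulrN lerN2 ler_wpM2r // v_out.
  move=> /(ler_wpM2l (ltW lam0)); lra.
have Gxi0 : 0 <= Gxi by exact: supnorm_ge0.
have LA0 : 0 <= LA by rewrite mulr_ge0.
have LN0 : 0 <= L * norm2inf J A by rewrite mulr_ge0 // norm2inf_ge0.
have mu0 := pmm_mu x_pmm.
have cone : N <= 2 * (c + 1) / (c - 2) * P.
  have cm2 : 0 < c - 2 by lra.
  have c0 : 0 < c by lra.
  rewrite mulrAC ler_pdivlMr // -(ler_pM2l lam0).
  have muD : 0 <= mu * enorm D ^+ 2 by rewrite mulr_ge0 ?sqr_ge0 // ltW.
  (* From optimality and a - t >= - L |h| >= - LA (P + N). *)
  have E0 : 0 <= LA * (P + N) + (Gxi * (P + N) + lambda * (vS * P - N / 2)).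
    have := ler_wpM2l LA0 DT; move: lip1; rewrite ler_norml; lra.
  (* Multiplying by [c], then using c (LA + Gxi) <= lambda and vS <= 1, leaves lambda (P + N) + c
     lambda (P - N/2) >= 0, which is the cone inequality. *)
  have := mulr_ge0 (ltW c0) E0.
  have := ler_wpM2r (addr_ge0 P0 N0) lam_ge.
  have := mulr_ge0 (ltW c0) (mulr_ge0 LA0 (addr_ge0 P0 N0)).
  have := ler_wpM2l (mulr_ge0 (ltW c0) (ltW lam0)) (ler_wpM2r P0 vS1).
  lra.
have PD : P <= Num.sqrt #|Sk|%:R * enorm D by exact: sum_blocks_le_enorm.
have sq_le : Num.sqrt #|Sk|%:R <= #|Sk|%:R :> R.
  have [->|] := posnP #|Sk|; first by rewrite sqrtr0.
  rewrite -(ler1n R) => S1.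
  rewrite -[leRHS]sqr_sqrtr ?ler0n // expr2 ler_peMl ?sqrtr_ge0 //.
  by rewrite -[leLHS]sqrtr1 ler_wsqrtr.
have REC : n%:R * kappa * rhobar * enorm D ^+ 2 <= rhobar / 2 * enorm h ^+ 2.
  (* The cone membership of [D] is witnessed by S^{k-1} itself. *)
  have : kappa * enorm D ^+ 2 <= (2 * n%:R)^-1 * enorm h ^+ 2 by apply: RE; exists Sk.
  move=> /(ler_wpM2l (mulr_ge0 (ler0n R n) (ltW rho0))) ineq.
  have -> : n%:R * kappa * rhobar * enorm D ^+ 2 =
    n%:R * rhobar * (kappa * enorm D ^+ 2) by ring.
  (* For n = 0 the inverse of 2n is the default 0 and the factor n kills the left side; otherwise
     the two sides are equal. *)
  apply: le_trans ineq _; have [n0|n0] := eqVneq (n%:R : R) 0.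
    by rewrite n0 !mul0r mulr_ge0 ?sqr_ge0 // divr_ge0 // ltW.
  by rewrite le_eqVlt; apply/orP; left; apply/eqP; field.
have qE : q = 3 * c / (c - 2) * (L * norm2inf J A) by rewrite /q; ring.
have c30 : 0 <= 3 * c by lra.
have c20 : 0 <= c - 2 by lra.
have q0 : 0 <= q by rewrite qE mulr_ge0 ?divr_ge0.
(* The upper end of the interval for lambda is exactly the condition d2 > 0. *)
have d2_gt0 : 0 < d2.
  have qvS0 : 0 <= q * vS * #|Sk|%:R.
    exact: mulr_ge0 (mulr_ge0 q0 vS0) (ler0n _ _).
  by have := lt_div_cross lam0 qvS0 lam_lt; rewrite /d2; lra.
rewrite /d1 /d2 qE.
apply: (@error_bound_arith _ LA Gxi lambda vS c P N _ t a (L * enorm h)) => //.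
- by rewrite mulr_ge0.
(* [REC] replaces rhobar/2 |h|^2 by n kappa rhobar |D|^2. *)
- by apply: le_trans scv; rewrite lerD2l.
- by rewrite -qE.
Qed.
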